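(* Let $\kappa$ be inaccessible and let $b,h:\kappa\to\kappa$ be increasing functions with $h\leq b$, each $b(\alpha)$ an infinite cardinal and each $h(\alpha)$ a nonzero cardinal. For each cardinal $\lambda<\kappa$ define $D_\lambda=\{\alpha\in\kappa\mid h(\alpha)=\lambda\}$. (i) If there exists a least cardinal $\lambda<\kappa$ such that $D_\lambda$ is cofinal in $\kappa$, then $\mathfrak b_\kappa^{b,h}(\in^* )=\lambda$. (ii) If $D_\lambda$ is bounded in $\kappa$ for all $\lambda<\kappa$ and $h$ is continuous on a stationary set, then $\mathfrak b_\kappa^{b,h}(\in^* )=\kappa$. (iii) If $D_\lambda$ is bounded in $\kappa$ for all $\lambda<\kappa$ and $h$ is discontinuous on a club set, then $\kappa^+\leq\mathfrak b_\kappa^{b,h}(\in^* )$.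
   Context: ''Increasing'' means not necessarily strictly increasing. An increasing function $h:\kappa\to\mathrm{Ord}$ is continuous (resp. discontinuous) on $A\subseteq\kappa$ if $h(\gamma)=\bigcup_{\alpha<\gamma}h(\alpha)$ (resp. $h(\gamma)>\bigcup_{\alpha<\gamma}h(\alpha)$) for every limit ordinal $\gamma\in A$. $\prod b$ is the set of functions $f$ with domain $\kappa$ and $f(\alpha)\in b(\alpha)$ for all $\alpha$. $\mathrm{Loc}_\kappa^{b,h}$ is the set of functions $\phi$ with domain $\kappa$ such that $\phi(\alpha)\subseteq b(\alpha)$ and $|\phi(\alpha)|<h(\alpha)$ for all $\alpha$. $f\in^*\phi$ means that there is $\beta<\kappa$ with $f(\alpha)\in\phi(\alpha)$ for all $\alpha>\beta$. The avoidance cardinal $\mathfrak b_\kappa^{b,h}(\in^* )$ is the least size of a set $\mathcal F\subseteq\prod b$ such that there is no $\phi\in\mathrm{Loc}_\kappa^{b,h}$ with $f\in^*\phi$ for all $f\in\mathcal F$. *)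

(* Defs.v *)
From HB Require Import structures.
From mathcomp Require Import all_boot all_order.
From mathcomp Require Export wochoice.
From mathcomp Require Export boolp classical_sets functions cardinality.

Set Implicit Arguments.
Unset Strict Implicit.
Unset Printing Implicit Defensive.

Import Order.TTheory.

Local Open Scope classical_set_scope.
Local Open Scope order_scope.
Local Open Scope card_scope.

(** * Cardinals

    A cardinal number is represented by any set of that cardinality, compared
    with [#<=] and [#=]. *)

Definition card_lt T U (A : set T) (B : set U) : Prop :=
  A #<= B /\ ~ (B #<= A).

(** A member of [P] of least cardinality: it exists as soon as [P] is nonempty
    ([least_cardP]). *)
Definition least_card T (P : set (set T)) : set T :=
  xget set0 [set X | P X /\ forall Y, P Y -> X #<= Y].

(** The successor cardinal. It is enough to look for it among the sets of
    subsets of [T], by Cantor's theorem: see [card_succ_gt] and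
    [card_succ_le], the latter for sets over arbitrary types. *)
Definition card_succ T (A : set T) : set (set T) :=
  least_card [set X : set (set T) | card_lt A X].

Lemma family_card_min (I T : Type) (X : I -> set T) (i0 : I) :
  exists i, forall j, X i #<= X j.
Proof.
pose P (S : set (I -> T)) := (forall s, S s -> forall i, X i (s i)) /\
  (forall s s', S s -> S s' -> forall i, s i = s' i -> s = s').
have [F FP Ftot|S [[SX Sinj] Smax]] := @Zorn_bigcup _ P.
  split=> [s [A FA As] i|s s' [A FA As] [B FB Bs'] i ss'].
    by have [+ _] := FP _ FA; apply.
  have [AB|BA] := Ftot _ _ FA FB.
    by have [_] := FP _ FB; apply; [exact: AB As|exact: Bs'|exact: ss'].
  by have [_] := FP _ FA; apply; [exact: As|exact: BA Bs'|exact: ss'].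
have [[i iS]|noi] := pselect (exists i, forall x, X i x -> exists2 s, S s & s i = x).
  exists i => j.
  have Xi : X i #= S.
    rewrite (_ : X i = (fun s => s i) @` S).
      apply: inj_card_eq => s s' /set_mem Ss /set_mem Ss'.
      exact: Sinj.
    apply/seteqP; split=> x.
      by move=> /iS[s Ss <-]; exists s.
    by move=> [s Ss <-]; exact: SX.
  rewrite (card_le_eql Xi).
  have Xj : (fun s => s j) @` S #= S.
    apply: inj_card_eq => s s' /set_mem Ss /set_mem Ss'.
    exact: Sinj.
  rewrite -(card_le_eql Xj); apply: subset_card_le => x [s Ss <-].
  exact: SX.
have /choice[t tP] : forall i, exists x, X i x /\ forall s, S s -> s i <> x.
  move=> i; apply: contrapT => no; apply: noi; exists i => x Xx.
  apply: contrapT => nos; apply: no; exists x; split=> // s Ss sx.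
  by apply: nos; exists s.
have St : ~ S t by move=> St; have [_ /(_ _ St)] := tP i0; apply.
exfalso; apply: (Smax (t |` S)).
  by split; [right|move=> /(_ t (or_introl erefl))].
split=> [s [->|/SX//] i|s s' [->|Ss] [->|Ss'] i //].
- by have [] := tP i.
- by move=> e; have [_ /(_ _ Ss')] := tP i; rewrite e.
- by move=> e; have [_ /(_ _ Ss)] := tP i; rewrite e.
exact: Sinj.
Qed.

Lemma least_cardP T (P : set (set T)) : P !=set0 ->
  P (least_card P) /\ forall Y, P Y -> least_card P #<= Y.
Proof.
move=> [X0 PX0]; apply: (@xgetPex _ set0 [set X | P X /\ _]).
have [[X PX] Xmin] := @family_card_min {X | P X} T sval (exist _ X0 PX0).
by exists X; split=> // Y PY; exact: (Xmin (exist _ Y PY)).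
Qed.

Lemma card_le_total T U (A : set T) (B : set U) : A #<= B \/ B #<= A.
Proof.
pose X (b : bool) : set (T + U) := if b then inl @` A else inr @` B.
have XA : X true #= A by apply: inj_card_eq => x y _ _ [].
have XB : X false #= B by apply: inj_card_eq => x y _ _ [].
have [[] Xmin] := family_card_min X true.
  by left; rewrite -(card_le_eql XA) -(card_le_eqr XB).
by right; rewrite -(card_le_eqr XA) -(card_le_eql XB).
Qed.

Lemma card_lt_powerset T (A : set T) : card_lt A [set: set T].
Proof.
split.
  apply: (@card_le_trans _ _ _ [set: T]); first exact: card_leT.
  apply/pcard_injP; exists (fun x => [set x]) => x y _ _ e.
  by have : [set x] x by []; rewrite e.
move=> /card_le_trans/(_ (card_leT A))/card_leP[f].
have {}[g ginj] : exists g : set T -> T, injective g.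
  exists (fun X => sval (f (SigSub (mem_set (I : [set: set T] X))))) => X Y.
  by move=> /val_inj/(@inj _ _ _ f) e; have [] := e (mem_set I) (mem_set I).
pose D : set T := [set x | exists2 X, x = g X & ~ X x].
have [|nD] := pselect (D (g D)).
  by move=> /[dup] DD [X /ginj <-]; apply.
by apply: (nD); exists D.
Qed.

Lemma card_succ_gt T (A : set T) : card_lt A (card_succ A).
Proof.
have [] := @least_cardP _ [set X : set (set T) | card_lt A X].
  by exists setT; exact: card_lt_powerset.
by [].
Qed.

Lemma card_succ_le T U (A : set T) (B : set U) :
  card_lt A B -> card_succ A #<= B.
Proof.
move=> AB.
have [_ smin] := @least_cardP _ [set X : set (set T) | card_lt A X]
  (ex_intro _ _ (card_lt_powerset A)).
have [BT|] := card_le_total B [set: set T]; last first.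
  by apply: card_le_trans; exact/smin/card_lt_powerset.
have [f] := pcard_leP BT.
have fB : f @` B #= B by apply: inj_card_eq; exact: inj.
rewrite -(card_le_eqr fB); apply: smin.
by case: AB => AB BA; split; rewrite (card_le_eqr fB, card_le_eql fB).
Qed.

(** * Ordinals

    An ordinal is a well-ordered type [K], whose elements are the smaller
    ordinals: [a : K] stands for the von Neumann ordinal [segment a]. *)

Section Ordinals.
Context {d : Order.disp_t} {K : orderType d}.
Implicit Types (a g lam : K) (A C : set K) (h : K -> K).

Definition segment a : set K := [set x | x < a].

Definition cardinal a : Prop :=
  forall x, x < a -> card_lt (segment x) (segment a).

Definition limit_ordinal g : Prop :=
  segment g !=set0 /\ forall x, x < g -> exists2 y, x < y & y < g.

Definition cofinal A : Prop := forall x, exists2 y, A y & x <= y.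

Definition club C : Prop :=
  cofinal C /\
  forall g, limit_ordinal g ->
    (forall x, x < g -> exists y, [/\ C y, x <= y & y < g]) -> C g.

Definition stationary A : Prop := forall C, club C -> (A `&` C) !=set0.

(** For ordinals, [=] and [>] are equality and strict inclusion of sets. *)
Definition continuous_on h A : Prop :=
  forall g, limit_ordinal g -> A g ->
    segment (h g) = \bigcup_(a in segment g) segment (h a).

Definition discontinuous_on h A : Prop :=
  forall g, limit_ordinal g -> A g ->
    \bigcup_(a in segment g) segment (h a) `<` segment (h g).

End Ordinals.

(** [K] is an uncountable regular strong limit cardinal. *)
Definition inaccessible d (K : orderType d) : Prop :=
  [/\ well_order (<=%O : rel K),
      forall a : K, card_lt (segment a) [set: K],
      ~ countable [set: K],
      forall A : set K, cofinal A -> A #= [set: K] &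
      forall a : K, cardinal a ->
        card_lt [set X : set K | X `<=` segment a] [set: K] ].

(** * Localisation and the avoidance cardinal *)

Section Localisation.
Context {d : Order.disp_t} {K : orderType d}.
Implicit Types (b h f : K -> K) (phi : K -> set K).

Definition prod_below b : set (K -> K) := [set f | forall a, f a < b a].

Definition Loc b h : set (K -> set K) :=
  [set phi | forall a, phi a `<=` segment (b a) /\
                       card_lt (phi a) (segment (h a))].

Definition in_star f phi : Prop := exists x, forall a, x < a -> phi a (f a).

Definition avoiding b h : set (set (K -> K)) :=
  [set F | F `<=` prod_below b /\
           ~ exists2 phi, Loc b h phi & forall f, F f -> in_star f phi].

Definition avoidance_card b h : set (K -> K) := least_card (avoiding b h).

Definition level_set h (lam : K) : set K := [set a | h a = lam].

Lemma avoiding_nonempty b h : (forall x : K, exists y, x < y) ->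
  (forall a, h a <= b a) -> avoiding b h !=set0.
Proof.
move=> nomax hb; exists (prod_below b); split=> // -[phi phiL phiP].
have /choice[f fP] : forall a, exists x, x < b a /\ ~ phi a x.
  move=> a; apply: contrapT => no; have [_ [_]] := phiL a; apply.
  apply: subset_card_le => x xh; apply: contrapT => nx; apply: no.
  by exists x; split=> //; exact: lt_le_trans (hb a).
have [a|x xP] := phiP f; first by have [] := fP a.
by have [y /xP] := nomax x; have [] := fP y.
Qed.

End Localisation.

(* Main.v *)
Require Import Defs.
From mathcomp Require Import all_boot all_order.
From mathcomp Require Import boolp classical_sets cardinality.

Set Implicit Arguments.
Unset Strict Implicit.
Unset Printing Implicit Defensive.

Local Open Scope classical_set_scope.
Local Open Scope order_scope.
Local Open Scope card_scope.

(** (i) is a counting argument: fewer than [lam] functions are localised by the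
    set of their values, while regularity shows that no slalom of width [lam]
    localises the [lam] constant functions.

    (ii) As [h] is unbounded, fewer than [K] functions are localised as in (i).
    The constant functions [f_xi] (cut off below [b]) avoid every slalom
    [phi]: if [f_xi] is caught by [phi] from [x_xi] on, then at a closure point
    [g] of [xi |-> x_xi] and [h] where [h] is continuous, every [xi < h g]
    satisfies [xi < h a] for some [a < g], so [x_xi < g] and [xi] is in [phi g];
    thus [phi g] has at least [h g] elements.

    (iii) Given functions [f_xi] for [xi] in [K], let [g] be the largest limit
    ordinal in the club that is at most [a], and let [phi a] be the set of the
    values [f_xi a] for [xi] below the supremum of [h] on [g]; as [h] jumps at
    [g], this supremum is less than [h g], which is at most [h a]. *)

Import Order.TTheory.

(** * Comparison of cardinals *)

Section Cardinality.
Context {T U : Type}.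
Implicit Types (A : set T) (B : set U).

Lemma card_lt_le_trans V A B (C : set V) : card_lt A B -> B #<= C -> card_lt A C.
Proof.
move=> [AB nBA] BC; split; first exact: card_le_trans BC.
by move=> CA; apply: nBA; exact: card_le_trans CA.
Qed.

Lemma card_le_lt_trans V A B (C : set V) : A #<= B -> card_lt B C -> card_lt A C.
Proof.
move=> AB [BC nCB]; split; first exact: card_le_trans BC.
by move=> CA; apply: nCB; exact: card_le_trans AB.
Qed.

Lemma card_ltNge A B : ~ (B #<= A) -> card_lt A B.
Proof. by move=> nBA; split=> //; have [|/nBA] := card_le_total A B. Qed.

End Cardinality.

(** An inhabitant of [U] makes a total function [e] possible even when [A] is empty. *)
Lemma card_le_inj T U (A : set T) (B : set U) : U -> A #<= B ->
  exists2 e : T -> U, forall x, A x -> B (e x) & {in A &, injective e}.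
Proof.
elim/Ppointed: U => U in B *; first by move=> /no.
move=> _ /pcard_leP[f]; exists f; last exact: inj.
by move=> x Ax; exact: funS.
Qed.

(** * Upper bounds, closure points and clubs in an inaccessible *)

Section WellOrder.
Context {d : Order.disp_t} {K : orderType d}.
Hypothesis K_inaccessible : inaccessible K.
Implicit Types (A C : set K) (f : K -> K) (a g x : K).

Lemma inaccessible_nonempty : [set: K] !=set0.
Proof.
case: K_inaccessible => _ _ unc _ _; apply/set0P/negP => /eqP K0.
by apply: unc; rewrite K0.
Qed.

Lemma least_elt A : A !=set0 -> exists2 m, A m & forall x, A x -> m <= x.
Proof.
case: K_inaccessible => wo _ _ _ _ [a Aa].
have [|m [[/set_mem Am mmin] _]] := wo (mem A).
  by exists a; exact/mem_set.
by exists m => // x /mem_set; exact: mmin.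
Qed.

(** Without a strict upper bound [A] would be cofinal, hence as large as [K] by regularity. *)
Lemma small_ubound A : ~ ([set: K] #<= A) -> exists x, forall y, A y -> y < x.
Proof.
case: K_inaccessible => _ _ _ reg _ nA; apply: contrapT => nx; apply: nA.
have /card_esym/card_eqPle[] // : A #= [set: K].
apply: reg => x; apply: contrapT => ny; apply: nx; exists x => y Ay.
by rewrite ltNge; apply/negP => xy; apply: ny; exists y.
Qed.

Lemma countable_ubound A : countable A -> exists x, forall y, A y -> y < x.
Proof.
case: K_inaccessible => _ _ unc _ _ Ac; apply: small_ubound => KA.
by apply: unc; exact: sub_countable Ac.
Qed.

Lemma exists_gt x : exists y, x < y.
Proof. by have [y yx] := countable_ubound (countable1 x); exists y; apply: yx. Qed.

Lemma segment_lt a : card_lt (segment a) [set: K].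
Proof. by case: K_inaccessible. Qed.

Lemma image_segment_ubound f a : exists x, forall c, c < a -> f c < x.
Proof.
have [|x xP] := @small_ubound (f @` segment a).
  by move=> /card_le_trans/(_ (card_image_le _ _)); have [] := segment_lt a.
by exists x => c ca; apply: xP; exists c.
Qed.

(** The supremum [g] of a sequence [s] of length omega works: it exists because [K] is regular and
    uncountable, and each [a < g] lies below some [s n], so that [f a < s n.+1]. *)
Lemma exists_closed_limit f x : exists g,
  [/\ limit_ordinal g, x < g & forall a, a < g -> f a < g].
Proof.
have /choice[F FP] : forall a, exists y, a < y /\ forall c, c <= a -> f c < y.
  (* Segments are strict, so [f] is bounded below some [a' > a] in order to cover [c = a]. *)
  move=> a; have [a' aa'] := exists_gt a.
  have [y yP] := image_segment_ubound f a'.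
  exists (Order.max a' y); split; first by rewrite lt_max aa'.
  by move=> c ca; rewrite lt_max yP ?orbT//; exact: le_lt_trans aa'.
pose s n := iter n F x.
have sS n : s n < s n.+1 by have [] := FP (s n).
have [|y yP] := @countable_ubound (range s).
  by apply: sub_countable (countableP [set: nat]); exact: card_image_le.
have [|g gs gmin] := @least_elt [set z | forall n, s n < z].
  by exists y => n; apply: yP; exists n.
have below a : a < g -> exists n, a <= s n.
  move=> ag; apply: contrapT => no; have : g <= a.
    apply: gmin => n; rewrite ltNge; apply/negP => an.
    by apply: no; exists n.
  by rewrite leNgt ag.
exists g; split; [split|exact: (gs 0)|].
- by exists x; exact: (gs 0).
- move=> a /below[n an]; exists (s n.+1); last exact: gs.
  exact: le_lt_trans (sS n).
move=> a /below[n an]; have [_ /(_ _ an) fs] := FP (s n).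
exact: lt_trans (gs n.+1).
Qed.

Lemma club_closed_limits f :
  club [set g | limit_ordinal g /\ forall a, a < g -> f a < g].
Proof.
split=> [x|g gl gC].
  have [g [gl xg fg]] := exists_closed_limit f x.
  by exists g => //; exact: ltW.
split=> // a ag; have [a' aa' a'g] := gl.2 _ ag.
have [y [[_ fy] a'y yg]] := gC _ a'g.
by apply: lt_trans yg; apply: fy; exact: lt_le_trans a'y.
Qed.

(** A club may contain non-limits, which discontinuity does not constrain. A limit closed under a
    choice of larger elements of [C] is itself in [C]. *)
Lemma club_limit_unbounded C x : club C ->
  exists g, [/\ C g, limit_ordinal g & x < g].
Proof.
move=> [Ccof Ccl].
have /choice[f fP] : forall a, exists y, C y /\ a <= y.
  by move=> a; have [y] := Ccof a; exists y.
have [g [gl xg fg]] := exists_closed_limit f x.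
exists g; split=> //; apply: Ccl => // a ag.
by have [Cf af] := fP a; exists (f a); split=> //; exact: fg.
Qed.

(** The supremum of the limits in [C] up to [a] is attained: otherwise it would be a limit of
    elements of [C], hence in [C] by closure. *)
Lemma club_limit_max C g0 a : club C -> C g0 -> limit_ordinal g0 -> g0 <= a ->
  exists g, [/\ C g, limit_ordinal g, g <= a &
    forall g', C g' -> limit_ordinal g' -> g' <= a -> g' <= g].
Proof.
move=> [_ Ccl] Cg0 g0l g0a; pose D := [set g | [/\ C g, limit_ordinal g & g <= a]].
have [|g gub gmin] := @least_elt [set z | forall g, D g -> g <= z].
  by exists a => g [].
have ga : g <= a by apply: gmin => g' [].
have [[Cg gl _]|nDg] := pselect (D g).
  by exists g; split=> // g' Cg' g'l g'a; apply: gub.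
have near x : x < g -> exists2 y, D y & x < y.
  move=> xg; apply: contrapT => no; have : g <= x.
    apply: gmin => y Dy; rewrite leNgt; apply/negP => xy.
    by apply: no; exists y.
  by rewrite leNgt xg.
have Dlt y : D y -> y < g.
  move=> Dy; rewrite lt_neqAle gub // andbT; apply/eqP => yg.
  by apply: nDg; rewrite -yg.
have gl : limit_ordinal g.
  split; first by exists g0; apply: Dlt.
  by move=> x /near[y Dy xy]; exists y => //; exact: Dlt.
exists g; split=> //; last by move=> g' *; apply: gub.
apply: Ccl => // x /near[y Dy xy]; exists y; split; last exact: Dlt.
  by case: Dy.
exact: ltW.
Qed.

End WellOrder.

Section Localisation.
Context {d : Order.disp_t} {K : orderType d}.
Hypothesis K_inaccessible : inaccessible K.
Variables b h : K -> K.
Hypothesis h_increasing : {homo h : x y / x <= y}.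
Hypothesis h_le_b : forall a, h a <= b a.
Hypothesis h_card : forall a, cardinal (h a) /\ segment (h a) !=set0.

Lemma avoidance_cardP : avoiding b h (avoidance_card b h) /\
  forall F, avoiding b h F -> avoidance_card b h #<= F.
Proof.
apply: least_cardP; apply: avoiding_nonempty => //.
exact: exists_gt K_inaccessible.
Qed.

Lemma Loc_image (F : set (K -> K)) (G : K -> set (K -> K)) :
  F `<=` prod_below b -> (forall a, G a `<=` F) ->
  (forall a, card_lt (G a) (segment (h a))) ->
  Loc b h (fun a => [set f a | f in G a]).
Proof.
move=> Fb GF Gh a; split.
  by move=> _ [f Gf <-]; apply: Fb; exact: GF Gf.
exact: card_le_lt_trans (card_image_le _ _) (Gh a).
Qed.

Lemma card_lt_set0_h a : card_lt (@set0 (K -> K)) (segment (h a)).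
Proof.
apply: card_ltNge => /card_le0P e; have [_ [x]] := h_card a.
by rewrite e.
Qed.

(** A smaller [F] is localised from [x] on by all its values. Before [x], where [h] may be too
    small, the slalom is empty. *)
Lemma avoiding_card_ge (F : set (K -> K)) x : avoiding b h F ->
  ~ card_lt F (segment (h x)).
Proof.
move=> [Fb nF] Fx; apply: nF.
pose G a := [set f | F f /\ x <= a].
exists (fun a => [set f a | f in G a]).
  apply: (Loc_image Fb) => [a f []//|a].
  have [xa|ax] := leP x a.
    apply: (card_le_lt_trans (_ : _ #<= F)).
      by apply: subset_card_le => f [].
    apply: card_lt_le_trans Fx _; apply: subset_card_le => y yx.
    by apply: lt_le_trans (h_increasing xa).
  rewrite (_ : G a = set0); first exact: card_lt_set0_h.
  by apply/seteqP; split=> // f [_]; rewrite leNgt ax.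
by move=> f Ff; exists x => a xa; exists f => //; split=> //; exact: ltW.
Qed.

Lemma cutoff_constants : exists c : K -> K -> K,
  (forall xi, prod_below b (c xi)) /\
  (forall xi a, xi < h a -> c xi a = xi).
Proof.
have /choice[z zb] : forall a, exists z, z < b a.
  move=> a; have [_ [z zh]] := h_card a; exists z.
  exact: lt_le_trans (h_le_b a).
exists (fun xi a => if xi < b a then xi else z a); split=> xi a.
  by case: ifP.
by move=> xh; rewrite (lt_le_trans xh).
Qed.

(** If [h] were bounded, regularity would give a [y] above the bounds of all level sets, yet [y]
    lies in the level set of [h y]. *)
Lemma unbounded_h :
  (forall lam : K, cardinal lam -> has_ubound (level_set h lam)) ->
  forall x, exists a, x < h a.
Proof.
move=> hD x; apply: contrapT => no.
have hx a : h a <= x by rewrite leNgt; apply/negP => xh; apply: no; exists a.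
have /choice[u uP] : forall mu, exists u, forall a, h a = mu -> a <= u.
  move=> mu; have [cmu|ncmu] := pselect (cardinal mu).
    by have [u uD] := hD _ cmu; exists u => a ha; exact: uD.
  (* The level set of a non-cardinal is empty, so any bound will do. *)
  by exists x => a ha; case: ncmu; rewrite -ha; exact: (h_card a).1.
have [x' xx'] := exists_gt K_inaccessible x.
have [y yP] := image_segment_ubound K_inaccessible u x'.
have := yP (h y) (le_lt_trans (hx y) xx').
by rewrite ltNge uP.
Qed.

Lemma avoidance_level lam : cofinal (level_set h lam) ->
  avoidance_card b h #= segment lam.
Proof.
move=> lcof.
have [x0 hx0 _] := lcof lam.
(* Monotonicity squeezes [h a] between its values at [x0] and at a later point of the level set. *)
have hlam a : x0 <= a -> h a = lam.
  move=> xa; have [y hy ay] := lcof a; apply/le_anti.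
  by rewrite -{1}hy -hx0 !h_increasing.
have [Fav Fmin] := avoidance_cardP.
rewrite card_eq_le; apply/andP; split; last first.
  have [//|nle] := pselect (segment lam #<= avoidance_card b h).
  by case: (avoiding_card_ge (x := x0) Fav); rewrite hx0; exact: card_ltNge.
have [c [cb ch]] := cutoff_constants.
apply: card_le_trans (card_image_le c _); apply: Fmin; split.
  by move=> _ [xi _ <-]; exact: cb.
move=> [phi phiL phiP].
have /choice[u uP] : forall xi, exists u, xi < lam ->
    forall a, u < a -> phi a (c xi a).
  move=> xi; have [xl|] := boolP (xi < lam); last by exists xi.
  by have [|u uP] := phiP (c xi); [exists xi|exists u].
(* By regularity [y] is a common threshold for the functions [c xi] with [xi < lam]. *)
have [y yP] := image_segment_ubound K_inaccessible u lam.
have [_] := phiL (Order.max x0 y); rewrite hlam ?le_max ?lexx// => -[_]; apply.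
apply: subset_card_le => xi xl.
rewrite -(ch xi (Order.max x0 y)); last by rewrite hlam// le_max lexx.
by apply: uP => //; rewrite lt_max yP ?orbT.
Qed.

(** A family smaller than [K] has a copy inside some [segment x], hence is smaller than any cardinal
    [h a > x]. *)
Lemma avoidance_ge : (forall x, exists a, x < h a) ->
  [set: K] #<= avoidance_card b h.
Proof.
move=> hunb; apply: contrapT => nKF.
have [FK _] := card_ltNge nKF.
have [Fav _] := avoidance_cardP.
have [k _] := inaccessible_nonempty K_inaccessible.
have [e _ einj] := card_le_inj k FK.
have eF := inj_card_eq einj.
have [|x xP] := @small_ubound _ _ K_inaccessible (e @` avoidance_card b h).
  by rewrite (card_le_eqr eF).
have [a xa] := hunb x; apply: (avoiding_card_ge (x := a) Fav).
apply: card_le_lt_trans ((h_card a).1 _ xa).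
by rewrite -(card_le_eql eF); exact: subset_card_le.
Qed.

Lemma avoidance_continuous S : (forall x, exists a, x < h a) ->
  stationary S -> continuous_on h S -> avoidance_card b h #= [set: K].
Proof.
move=> hunb Sst hS; rewrite card_eq_le (avoidance_ge hunb) andbT.
have [c [cb ch]] := cutoff_constants.
apply: card_le_trans (card_image_le c setT).
apply: (avoidance_cardP.2); split.
  by move=> _ [xi _ <-]; exact: cb.
move=> [phi phiL phiP].
have /choice[u uP] : forall xi, exists u, forall a, u < a -> phi a (c xi a).
  by move=> xi; apply: phiP; exists xi.
have [g [Sg [gl gu]]] := Sst _ (club_closed_limits K_inaccessible
  (fun a => Order.max (u a) (h a))).
have hgE := hS _ gl Sg.
have [_ [_]] := phiL g; apply; apply: subset_card_le => xi xg.
rewrite -(ch xi g xg); apply: uP.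
have : segment (h g) xi by [].
rewrite hgE => -[a ag xa].
(* Closure under [h] gives [xi < g], so that closure under [u] applies to [xi]. *)
have hag : h a < g by have := gu _ ag; rewrite gt_max => /andP[].
by have := gu _ (lt_trans xa hag); rewrite gt_max => /andP[].
Qed.

Lemma avoidance_discontinuous C : (forall x, exists a, x < h a) ->
  club C -> discontinuous_on h C -> card_succ [set: K] #<= avoidance_card b h.
Proof.
move=> hunb Ccl hC; apply: card_succ_le; apply: card_ltNge => FK.
have [[Fb nF] _] := avoidance_cardP; apply: nF.
have [k _] := inaccessible_nonempty K_inaccessible.
have [e _ einj] := card_le_inj k FK.
(* A union over all limits [g <= a] in [C] avoids choosing the largest one, which serves only to
   bound the size. *)
pose U a := [set xi | exists g, [/\ C g, limit_ordinal g, g <= a &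
  (\bigcup_(x in segment g) segment (h x)) xi]].
pose G a := [set f | avoidance_card b h f /\ U a (e f)].
exists (fun a => [set f a | f in G a]); last first.
  move=> f Ff; have [x fx] := hunb (e f).
  have [g [Cg gl xg]] := club_limit_unbounded K_inaccessible x Ccl.
  exists g => a ga; exists f => //; split=> //.
  by exists g; split=> //; [exact: ltW|exists x].
apply: (Loc_image Fb) => [a f []//|a].
have [[g0 [Cg0 g0l g0a]]|nog] :=
    pselect (exists g, [/\ C g, limit_ordinal g & g <= a]); last first.
  rewrite (_ : G a = set0); first exact: card_lt_set0_h.
  apply/seteqP; split=> // f [_ [g [Cg gl ga _]]].
  by apply: nog; exists g.
have [g [Cg gl ga gmax]] := club_limit_max K_inaccessible Ccl Cg0 g0l g0a.
have [Vsub nVsub] := hC _ gl Cg.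
(* The jump at [g] leaves an [s] below [h g]; since [h a] is a cardinal above [s], [segment s] is
   small enough. *)
have [s sg nVs] : exists2 s, s < h g & forall x, x < g -> h x <= s.
  apply: contrapT => no; apply: nVsub => s sg; apply: contrapT => ns.
  apply: no; exists s => // x xg; rewrite leNgt; apply/negP => sx.
  by apply: ns; exists x.
apply: (card_le_lt_trans _ ((h_card a).1 s _)); last first.
  by apply: lt_le_trans sg _; exact: h_increasing.
have eG : e @` G a #= G a.
  apply: inj_card_eq => f f' /set_mem[Ff _] /set_mem[Ff' _].
  by apply: einj; exact/mem_set.
rewrite -(card_le_eql eG); apply: subset_card_le.
move=> _ [f [_ [g' [Cg' g'l g'a [x xg' fx]]]] <-].
apply: lt_le_trans fx _; apply: nVs; apply: lt_le_trans xg' _.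
exact: gmax.
Qed.

End Localisation.

Theorem lemma3p17 (d : Order.disp_t) (K : orderType d) (b h : K -> K)
    (K_inaccessible : inaccessible K)
    (b_increasing : {homo b : x y / x <= y})
    (h_increasing : {homo h : x y / x <= y})
    (h_le_b : forall a, h a <= b a)
    (b_card : forall a, cardinal (b a) /\ infinite_set (segment (b a)))
    (h_card : forall a, cardinal (h a) /\ segment (h a) !=set0) :
  [/\ forall lam : K,
        cardinal lam -> cofinal (level_set h lam) ->
        (forall mu : K, cardinal mu -> cofinal (level_set h mu) -> lam <= mu) ->
        avoidance_card b h #= segment lam,
      (forall lam : K, cardinal lam -> has_ubound (level_set h lam)) ->
        (exists2 S, stationary S & continuous_on h S) ->
        avoidance_card b h #= [set: K]
    & (forall lam : K, cardinal lam -> has_ubound (level_set h lam)) ->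
        (exists2 C, club C & discontinuous_on h C) ->
        card_succ [set: K] #<= avoidance_card b h ].
Proof.
split.
- by move=> lam _ lcof _; exact: avoidance_level.
- by move=> hD [S Sst hS]; apply: (avoidance_continuous _ _ _ _ _ Sst hS) => //;
    exact: unbounded_h.
- by move=> hD [C Ccl hC]; apply: (avoidance_discontinuous _ _ _ _ _ Ccl hC) => //;
    exact: unbounded_h.
Qed.
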